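(* Let $F$ be a field of characteristic zero, $W$ a unital $F$-algebra, $k\geq 2$, and let $M_k$ be the $W$-algebra $M_k(F)$ of $k\times k$ matrices, where $W$ acts on it as $M_k(F)$ itself by left and right multiplication. Then the $W$-variety $\mathrm{var}^W(M_k)$ has almost polynomial growth.
   Context: All algebras are associative over a field $F$ of characteristic zero; $W$ is a unital $F$-algebra. A $W$-algebra is an $F$-algebra $A$ that is a unital $W$-bimodule (so $(w_1a)w_2=w_1(aw_2)$ and $1_Wa=a1_W=a$) such that $(a_1a_2)w=a_1(a_2w)$, $w(a_1a_2)=(wa_1)a_2$, $(a_1w)a_2=a_1(wa_2)$ for all $a_1,a_2\in A$, $w\in W$. The free $W$-algebra $W\langle X\rangle$ on $X=\{x_1,x_2,\ldots\}$ has $F$-basis $\{w_{i_0}x_{j_1}w_{i_1}x_{j_2}\cdots x_{j_n}w_{i_n}\mid n\geq 1\}$, where the $w_{i_r}$ run over a fixed basis of $W$ and $j_1,\dots,j_n\ge1$ (expressions are multilinear in the $W$-entries); the product is juxtaposition followed by multiplication in $W$, $W$ acts by multiplying the outer entries, and $x_i=1_Wx_i1_W$. $\mathrm{Id}^W(A)$ is the set of $f\in W\langle X\rangle$ vanishing under all evaluations of the variables in the $W$-algebra $A$. $P_n^W$ is the space of multilinear elements of $W\langle X\rangle$ in $x_1,\dots,x_n$, and $c_n^W(A)=\dim_F P_n^W/(P_n^W\cap \mathrm{Id}^W(A))$. The $W$-variety $\mathrm{var}^W(A)$ generated by $A$ is the class of all $W$-algebras $B$ with $\mathrm{Id}^W(A)\subseteq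 \mathrm{Id}^W(B)$; for $\mathcal V=\mathrm{var}^W(A)$ put $\mathrm{Id}^W(\mathcal V)=\mathrm{Id}^W(A)$ and $c_n^W(\mathcal V)=c_n^W(A)$. $\mathcal V$ has polynomial growth if $c_n^W(\mathcal V)$, $n\ge 1$, is polynomially bounded, and almost polynomial growth if $c_n^W(\mathcal V)$ is not polynomially bounded but every proper $W$-subvariety of $\mathcal V$ has polynomial growth. ''$W$ acts on $M_k(F)$ as $M_k(F)$ itself by left and right multiplication'' means that there is a surjective homomorphism of unital algebras $\theta:W\to M_k(F)$ such that $wa=\theta(w)a$ and $aw=a\theta(w)$ for all $w\in W$, $a\in M_k(F)$. *)

(* Defs.v *)
From HB Require Import structures.
From mathcomp Require Import all_boot all_order all_algebra finmap.
From mathcomp Require Import boolp classical_sets.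
From mathcomp.multinomials Require Import monalg.

Set Implicit Arguments.
Unset Strict Implicit.
Unset Printing Implicit Defensive.

Import GRing.Theory.
Local Open Scope classical_set_scope.
Local Open Scope ring_scope.

(* The library has no non-unital algebras, so the multiplication of [A] is part
   of the structure.  Both actions of [W] are [F]-bilinear, as required by the
   multilinearity of the expressions w_0 x_{j_1} w_1 ... x_{j_n} w_n in their
   entries from [W]. *)
HB.mixin Record isWAlgebra (F : fieldType) (W : algType F) A
    of GRing.Lmodule F A := {
  wmul : A -> A -> A;
  lact : W -> A -> A;
  ract : A -> W -> A;
  wmul_linearl : forall b, linear (wmul^~ b);
  wmul_linearr : forall a, linear (wmul a);
  lact_linearl : forall a, linear (lact^~ a);
  lact_linearr : forall w, linear (lact w);
  ract_linearl : forall w, linear (ract^~ w);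
  ract_linearr : forall a, linear (ract a);
  wmulA : associative wmul;
  lact1 : forall a, lact 1 a = a;
  lactM : forall v w a, lact (v * w) a = lact v (lact w a);
  ract1 : forall a, ract a 1 = a;
  ractM : forall a v w, ract a (v * w) = ract (ract a v) w;
  lractA : forall v a w, ract (lact v a) w = lact v (ract a w);
  wmul_ract : forall a b w, ract (wmul a b) w = wmul a (ract b w);
  wmul_lact : forall w a b, lact w (wmul a b) = wmul (lact w a) b;
  wmul_mid : forall a w b, wmul (ract a w) b = wmul a (lact w b)
}.

#[short(type="wAlgType")]
HB.structure Definition WAlgebra (F : fieldType) (W : algType F) :=
  {A of GRing.Lmodule F A & isWAlgebra F W A}.

Section MatrixWAlgebra.
Variables (F : fieldType) (W : algType F) (k : nat).

Definition matW (theta : {linear W -> 'M[F]_k}) (thetaM : monoid_morphism theta)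
  : Type := 'M[F]_k.

Variables (theta : {linear W -> 'M[F]_k}) (thetaM : monoid_morphism theta).

HB.instance Definition _ := GRing.Lmodule.on (matW thetaM).

Let A : lmodType F := matW thetaM.
Let mmul (a b : A) : A := (a : 'M[F]_k) *m b.
Let mlact (w : W) (a : A) : A := theta w *m a.
Let mract (a : A) (w : W) : A := (a : 'M[F]_k) *m theta w.

Let mmul_linearl b : linear (mmul^~ b).
Proof. by move=> c x y; rewrite /mmul mulmxDl scalemxAl. Qed.
Let mmul_linearr a : linear (mmul a).
Proof. by move=> c x y; rewrite /mmul mulmxDr scalemxAr. Qed.
Let mlact_linearl a : linear (mlact^~ a).
Proof. by move=> c x y; rewrite /mlact linearP mulmxDl scalemxAl. Qed.
Let mlact_linearr w : linear (mlact w).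
Proof. by move=> c x y; rewrite /mlact mulmxDr scalemxAr. Qed.
Let mract_linearl w : linear (mract^~ w).
Proof. by move=> c x y; rewrite /mract mulmxDl scalemxAl. Qed.
Let mract_linearr a : linear (mract a).
Proof. by move=> c x y; rewrite /mract linearP mulmxDr scalemxAr. Qed.
Let mmulA : associative mmul.
Proof. exact: mulmxA. Qed.
Let mlact1 a : mlact 1 a = a.
Proof. by rewrite /mlact thetaM.1 mul1mx. Qed.
Let mlactM v w a : mlact (v * w) a = mlact v (mlact w a).
Proof. by rewrite /mlact thetaM.2 -mulmxA. Qed.
Let mract1 a : mract a 1 = a.
Proof. by rewrite /mract thetaM.1 mulmx1. Qed.
Let mractM a v w : mract a (v * w) = mract (mract a v) w.
Proof. by rewrite /mract thetaM.2 -mulmxA. Qed.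
Let mlractA v a w : mract (mlact v a) w = mlact v (mract a w).
Proof. by rewrite /mract /mlact mulmxA. Qed.
Let mmul_ract a b w : mract (mmul a b) w = mmul a (mract b w).
Proof. by rewrite /mract /mmul mulmxA. Qed.
Let mmul_lact w a b : mlact w (mmul a b) = mmul (mlact w a) b.
Proof. by rewrite /mlact /mmul mulmxA. Qed.
Let mmul_mid a w b : mmul (mract a w) b = mmul a (mlact w b).
Proof. by rewrite /mract /mlact /mmul mulmxA. Qed.

HB.instance Definition _ := isWAlgebra.Build F W (matW thetaM)
  mmul_linearl mmul_linearr mlact_linearl mlact_linearr mract_linearl
  mract_linearr mmulA mlact1 mlactM mract1 mractM mlractA mmul_ract mmul_lact
  mmul_mid.

End MatrixWAlgebra.

Section Basis.
Variables (F : fieldType) (V : lmodType F).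

Definition lin_indep (B : set V) : Prop :=
  forall (s : seq V) (c : V -> F), uniq s -> (forall v, v \in s -> B v) ->
    \sum_(v <- s) c v *: v = 0 -> forall v, v \in s -> c v = 0.

Definition lin_span (B : set V) : set V :=
  [set u | exists s : seq V, exists2 c : V -> F,
    forall v, v \in s -> B v & u = \sum_(v <- s) c v *: v].

Definition is_basis (B : set V) : Prop :=
  lin_indep B /\ forall u, lin_span B u.

Lemma basis_exists : exists B : set V, is_basis B.
Proof.
have chain (C : set (set V)) : C `<=` lin_indep -> total_on C subset ->
    lin_indep (\bigcup_(X in C) X).
  move=> CI Ctot [|x0 s] // c us sC.
  suff [X CX sX] : exists2 X, C X & forall v, v \in x0 :: s -> X v.
    exact: CI CX _ _ us sX.
  clear us; elim: s x0 sC => [|y s IHs] x sC.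
    by have [|X CX Xx] := sC x; rewrite ?mem_head//; exists X => // v /[!inE] /eqP->.
  have [v vs|X CX sX] := IHs y; first by apply: sC; rewrite inE vs orbT.
  have [|Y CY Yx] := sC x; first exact: mem_head.
  case: (Ctot X Y CX CY) => XY; [exists Y|exists X] => // v.
    by rewrite inE => /predU1P[->//|/sX/XY].
  by rewrite inE => /predU1P[->|/sX//]; apply: XY.
have [B [BI Bmax]] := Zorn_bigcup chain.
exists B; split=> // u; apply: contrapT => nu.
have nBu : ~ B u.
  move=> Bu; apply: nu; exists [:: u], (fun=> 1); first by move=> v /[!inE] /eqP->.
  by rewrite big_seq1 scale1r.
have ltB : B `<` (u |` B).
  by split=> [v Bv|/(_ u) uB]; [right|apply: nBu; apply: uB; left].
apply: (Bmax _ ltB) => s c us sB sum0.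
have [us0|nus] := boolP (u \in s); last first.
  move=> v vs; apply: (BI s) => // w ws; case: (sB w ws) => // wu.
  by rewrite -wu ws in nus.
have sB' v : v \in rem u s -> B v.
  rewrite mem_rem_uniq// inE => /andP[/eqP vu vs].
  by case: (sB v vs) => // /vu.
have E : c u *: u + \sum_(v <- rem u s) c v *: v = 0.
  by move: sum0; rewrite (perm_big _ (perm_to_rem us0)) big_cons.
have cu0 : c u = 0.
  apply: contrapT => /eqP cu; apply: nu; exists (rem u s), (fun v => - (c u)^-1 * c v) => //.
  under eq_bigr do rewrite -scalerA; rewrite -scaler_sumr.
  move/eqP: E; rewrite addr_eq0 => /eqP E.
  by rewrite scaleNr -scalerN -E scalerA mulVf// scale1r.
move: E; rewrite cu0 scale0r add0r => E v vs.
have [->//|vu] := eqVneq v u.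
by apply: (BI (rem u s)) E _ _; rewrite ?rem_uniq// mem_rem_uniq// inE vu.
Qed.

Definition fixed_basis : set V := projT1 (cid basis_exists).

Lemma fixed_basisP : is_basis fixed_basis.
Proof. exact: (projT2 (cid basis_exists)). Qed.

End Basis.

Section GeneralizedPolynomials.
Variables (F : fieldType) (W : algType F).

Definition wbasis : choiceType := {w : W | w \in @fixed_basis F W}.

(* [(i0, (j1, i1), [:: (j2, i2); ...; (jn, in)])] encodes the basis element
   w_{i0} x_{j1} w_{i1} x_{j2} ... x_{jn} w_{in}; the variables are numbered
   from 0, so the index [j] stands for x_{j+1}. *)
Definition gmonom : choiceType := (wbasis * (nat * wbasis) * seq (nat * wbasis))%type.

Definition gletters (m : gmonom) : seq nat := m.1.2.1 :: map fst m.2.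

(* The underlying vector space of W<X>: finitely supported functions from its
   basis to F. *)
Definition freeW : lmodType F := {malg F[gmonom]}.

Definition eval_gmonom (A : wAlgType W) (a : nat -> A) (m : gmonom) : A :=
  foldl (fun b (p : nat * wbasis) => wmul b (ract (a p.1) (val p.2)))
    (lact (val m.1.1) (ract (a m.1.2.1) (val m.1.2.2))) m.2.

Definition evalW (A : wAlgType W) (a : nat -> A) (f : freeW) : A :=
  \sum_(m <- msupp f) f@_m *: eval_gmonom a m.

Definition IdW (A : wAlgType W) : set freeW :=
  [set f | forall a : nat -> A, evalW a f = 0].

Definition multilinearW (n : nat) : set freeW :=
  [set f | forall m, m \in msupp f -> perm_eq (gletters m) (iota 0 n)].

Definition is_quotient_dim (P Q : set freeW) (d : nat) : Prop :=
  exists e : 'I_d -> freeW,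
    [/\ forall i, P (e i),
        forall c : 'I_d -> F, Q (\sum_i c i *: e i) -> forall i, c i = 0
      & forall f, P f -> exists c : 'I_d -> F, Q (f - \sum_i c i *: e i)].

(* dim_F P / Q for subspaces Q of P; [None] stands for an infinite dimension. *)
Definition quotient_dim (P Q : set freeW) : option nat :=
  xget None [set od | exists2 d, od = Some d & is_quotient_dim P Q d].

(* Classes of W-algebras are plain predicates: [set (wAlgType W)] is rejected
   with a universe inconsistency. *)
Definition varW (A B : wAlgType W) : Prop := IdW A `<=` IdW B.

Definition is_varietyW (V : wAlgType W -> Prop) : Prop := exists A, V = varW A.

Definition proper_subclass (U V : wAlgType W -> Prop) : Prop :=
  (forall B, U B -> V B) /\ exists2 B, V B & ~ U B.

Definition IdV (V : wAlgType W -> Prop) : set freeW :=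
  [set f | forall B, V B -> IdW B f].

Lemma IdV_varW (A : wAlgType W) : IdV (varW A) = IdW A.
Proof. by apply/seteqP; split=> f; [apply|move=> fA B; apply]. Qed.

Definition codimV (V : wAlgType W -> Prop) (n : nat) : option nat :=
  quotient_dim (multilinearW n) (multilinearW n `&` IdV V).

Definition polynomial_growth (V : wAlgType W -> Prop) : Prop :=
  exists C t : nat, forall n, (1 <= n)%N ->
    exists2 d, codimV V n = Some d & (d <= C * n ^ t)%N.

Definition almost_polynomial_growth (V : wAlgType W -> Prop) : Prop :=
  ~ polynomial_growth V /\
  forall U, is_varietyW U -> proper_subclass U V -> polynomial_growth U.

End GeneralizedPolynomials.

(* Main.v *)
Require Import Defs.
From mathcomp Require Import all_boot all_order all_algebra finmap.
From mathcomp Require Import boolp classical_sets functions.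
From mathcomp.multinomials Require Import monalg.
From mathcomp Require Import zify.

Set Implicit Arguments.
Unset Strict Implicit.
Unset Printing Implicit Defensive.

Import GRing.Theory.
Local Open Scope ring_scope.

(** Write [A] for the matrix algebra and [E i j] for its matrix units, which are
    images of elements of [W].

    Exponential growth. The word [E 0 r_0 x_0 E 0 r_1 x_1 ... x_n E 0 r_(n+1)]
    takes at [x_i = E t_i 0] the value [E 0 r_(n+1)] if [r_i = t_i] for all
    [i <= n], and zero otherwise. With two available rows this gives [2 ^ (n + 1)]
    multilinear elements that are independent modulo the identities
    ([codim_ge_expn]).

    Finite codimensions. By multilinearity an element of degree [n] is
    determined, modulo the identities of [A], by its values at tuples of matrix
    units. Every algebra of the variety has more identities than [A], hence has
    finite codimensions too ([codim_bound]).

    Proper subvarieties. Let [B] satisfy the identities of [A] and an identity [f]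
    that [A] does not satisfy. The functions on [A] given by identities of [B] are
    stable under the left and right action of [W], hence under multiplication by
    constant matrices; so they are the matrices with entries in some ideal of
    scalar functions. If [f] does not vanish at constant matrices [al_i], the
    substitution [x_i := g al_i], for a scalar polynomial [g] without constant
    term in the entries of the variables, gives a nonzero polynomial in [g]; in
    characteristic zero, its homogeneous components can be separated by scaling
    [g], and [g ^ d] lies in the ideal for some [d] independent of [g]
    ([Id_entry_power]). Polarizing, every product of [d] entries of variables lies
    in the ideal ([absorbed_power]). The entries of a monomial of degree at least
    [d] are combinations of multiples of such products, so that all polynomials of
    degree at least [d] agree on [A] with identities of [B], and are therefore
    identities of [B] ([Id_long_letters]). Thus all but finitely many codimensions
    of [B] are zero.

    All these constructions use that operations on polynomial functions
    (products, actions of [W], substitutions) come from elements of the free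
    algebra that do not depend on the algebra of evaluation ([realizes]). *)

(** * Subspaces, linear maps and relative dimension *)

Section LinearAlgebra.
Variable F : fieldType.

Definition is_subspace (V : lmodType F) (S : V -> Prop) : Prop :=
  S 0 /\ forall (c : F) u v, S u -> S v -> S (c *: u + v).

Lemma is_subspace_sum (V : lmodType F) (S : V -> Prop) (I : Type) (r : seq I)
    (P : pred I) (c : I -> F) (v : I -> V) :
  is_subspace S -> (forall i, P i -> S (v i)) ->
  S (\sum_(i <- r | P i) c i *: v i).
Proof.
move=> [S0 SD] Sv; elim/big_ind: _ => // [x y Sx Sy|i Pi].
  by rewrite -[x]scale1r; apply: SD.
by rewrite -[_ *: _]addr0; apply: SD => //; apply: Sv.
Qed.

Lemma is_subspaceZ (V : lmodType F) (S : V -> Prop) (c : F) v :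
  is_subspace S -> S v -> S (c *: v).
Proof. by move=> [S0 SD] Sv; rewrite -[_ *: _]addr0; apply: SD. Qed.

Lemma linear_zero (U V : lmodType F) (f : U -> V) : linear f -> f 0 = 0.
Proof.
by move=> fl; have := fl (-1) 0 0; rewrite scaleN1r addr0 oppr0 scaleN1r addNr.
Qed.

Lemma linear_comb (U V : lmodType F) (f : U -> V) (I : Type) (r : seq I)
    (P : pred I) (c : I -> F) (v : I -> U) :
  linear f ->
  f (\sum_(i <- r | P i) c i *: v i) = \sum_(i <- r | P i) c i *: f (v i).
Proof.
move=> fl; elim: r => [|i r IHr]; first by rewrite !big_nil linear_zero.
by rewrite !big_cons; case: (P i); rewrite // fl IHr.
Qed.

Lemma linear_delta_eq0 (m n : nat) (V : lmodType F) (f : 'M[F]_(m, n) -> V) :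
  linear f -> (forall i j, f (delta_mx i j) = 0) -> forall A, f A = 0.
Proof.
move=> fl f0 A; rewrite [A]matrix_sum_delta pair_big /=.
rewrite (linear_comb _ _ (fun p => A p.1 p.2) (fun p => delta_mx p.1 p.2)) //.
by apply: big1 => p _; rewrite f0 scaler0.
Qed.

Lemma exists_ker_row (m n : nat) (M : 'M[F]_(m, n)) :
  (n < m)%N -> exists2 u : 'rV[F]_m, u != 0 & u *m M = 0.
Proof.
move=> ltnm; have : kermx M != 0.
  rewrite -mxrank_eq0 mxrank_ker -lt0n subn_gt0.
  exact: leq_ltn_trans (rank_leq_col M) ltnm.
by case/rowV0Pn=> u /sub_kermxP uM u0; exists u.
Qed.

(** Modulo [Q], the coefficients of the independent family on the spanning one
    form a matrix with trivial row kernel. *)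
Lemma indep_le_span (V : lmodType F) (Q : V -> Prop) (N d : nat)
    (x : 'I_N -> V) (e : 'I_d -> V) :
  is_subspace Q ->
  (forall c : 'I_N -> F, Q (\sum_i c i *: x i) -> forall i, c i = 0) ->
  (forall i, exists c : 'I_d -> F, Q (x i - \sum_j c j *: e j)) ->
  (N <= d)%N.
Proof.
move=> Qs xI /choice [C xC]; rewrite leqNgt; apply/negP => /exists_ker_row.
move=> /(_ (\matrix_(i, j) C i j)) [u u0 uC]; case/eqP: u0.
apply/rowP => i; rewrite mxE; apply: xI i.
have -> : \sum_i u 0 i *: x i
    = \sum_i u 0 i *: (x i - \sum_j C i j *: e j).
  under [RHS]eq_bigr do rewrite scalerBr scaler_sumr.
  rewrite sumrB exchange_big /= [X in _ - X]big1 ?subr0 // => j _.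
  under eq_bigr do rewrite scalerA.
  rewrite -scaler_suml; move/rowP/(_ j): uC; rewrite !mxE => uCj.
  rewrite -[RHS](scale0r (e j)) -[X in _ = X *: _]uCj; congr (_ *: _).
  by apply: eq_bigr => l _; rewrite mxE.
by apply: is_subspace_sum => // i' _; exact: xC.
Qed.

End LinearAlgebra.

Section QuotientDim.
Variables (F : fieldType) (W : algType F).
Local Notation freeW := (freeW W).
Implicit Types P Q : set freeW.

Lemma quotient_dimP P Q d :
  quotient_dim P Q = Some d -> is_quotient_dim P Q d.
Proof.
rewrite /quotient_dim; case: xgetP => // od _ [d' -> Pd'] [<-]; exact: Pd'.
Qed.

Lemma quotient_dim_ex P Q d :
  is_quotient_dim P Q d -> exists d', quotient_dim P Q = Some d'.
Proof.
move=> Pd; rewrite /quotient_dim; case: xgetP => [od _ [d' -> _]|/(_ (Some d))].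
  by exists d'.
by case; exists d.
Qed.

Lemma quotient_dim_ge P Q N d (x : 'I_N -> freeW) :
  is_subspace Q -> (forall i, P (x i)) ->
  (forall c : 'I_N -> F, Q (\sum_i c i *: x i) -> forall i, c i = 0) ->
  quotient_dim P Q = Some d -> (N <= d)%N.
Proof.
move=> Qs Px xI /quotient_dimP [e [_ _ eS]].
by apply: indep_le_span Qs xI _ => i; apply: eS.
Qed.

(** Among the finite families of [P] that are independent modulo [Q], those of
    maximal size span. A maximal size exists because [Phi] maps such a family to
    an independent family of row vectors. *)
Lemma quotient_dim_le P Q N (Phi : freeW -> 'rV[F]_N) :
  is_subspace P -> is_subspace Q -> linear Phi ->
  (forall f, P f -> Phi f = 0 -> Q f) ->
  exists2 d, quotient_dim P Q = Some d & (d <= N)%N.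
Proof.
move=> Ps Qs Phil PhiQ.
pose indep d := exists e : 'I_d -> freeW, (forall i, P (e i)) /\
  forall c : 'I_d -> F, Q (\sum_i c i *: e i) -> forall i, c i = 0.
have indep_le d : indep d -> (d <= N)%N.
  move=> [e [Pe eI]]; rewrite leqNgt; apply/negP => /exists_ker_row.
  move=> /(_ _ (\matrix_i Phi (e i))) [u u0 uM]; case/eqP: u0.
  apply/rowP => i; rewrite mxE; apply: (eI (fun i => u 0 i)) i.
  apply: PhiQ; first exact: is_subspace_sum.
  rewrite linear_comb // -[RHS]uM mulmx_sum_row.
  by apply: eq_bigr => i _; rewrite rowK.
have [d /asboolP [e [Pe eI]] dmax] : exists2 d, `[<indep d>]
    & forall d', `[<indep d'>] -> (d' <= d)%N.
  have exd : exists d, `[<indep d>].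
    exists 0%N; apply/asboolP; exists (fun=> 0); split=> [[]//|c _ []//].
  have bd d : `[<indep d>] -> (d <= N)%N by move/asboolP/indep_le.
  by case: (ex_maxnP exd bd) => d dI dmax; exists d.
have [|d' Pd'] := @quotient_dim_ex P Q d.
  exists e; split=> // f Pf; apply: contrapT => nf.
  suff /dmax : `[<indep d.+1>] by rewrite ltnn.
  apply/asboolP.
  exists (fun i => if unlift ord0 i is Some j then e j else f); split.
    by move=> i; case: unliftP.
  move=> c; rewrite big_ord_recl unlift_none.
  under eq_bigr do rewrite liftK.
  move=> Qc; have c0 : c ord0 = 0.
    apply/eqP/negP => /negP c0; apply: nf.
    exists (fun j => - (c ord0)^-1 * c (lift ord0 j)).
    rewrite (_ : _ - _ = (c ord0)^-1 *: (c ord0 *: f + \sum_j c (lift ord0 j) *: e j)).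
      exact: is_subspaceZ.
    rewrite scalerDr scalerA mulVf // scale1r; congr (_ + _).
    rewrite scaler_sumr -sumrN; apply: eq_bigr => j _.
    by rewrite mulNr scaleNr opprK scalerA.
  move: Qc; rewrite c0 scale0r add0r => /eI c1 i.
  by case: (unliftP ord0 i) => [j|] ->.
exists d' => //; apply: indep_le.
by have [e' [Pe' e'I _]] := quotient_dimP Pd'; exists e'.
Qed.

End QuotientDim.

(** * Evaluation of generalized polynomials *)

Section Evaluation.
Variables (F : fieldType) (W : algType F).
Local Notation freeW := (freeW W).
Local Notation gmonom := (gmonom W).
Local Notation wbasis := (wbasis W).
Local Open Scope fset_scope.

Lemma evalWw (A : wAlgType W) (a : nat -> A) (f : freeW) (d : {fset gmonom}) :
  msupp f `<=` d -> evalW a f = \sum_(m <- d) f@_m *: eval_gmonom a m.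
Proof.
move=> fd; rewrite /evalW (big_fset_incl _ fd) // => m _.
by move/mcoeff_outdom ->; rewrite scale0r.
Qed.

Lemma msupp_comb (c : F) (f g : freeW) :
  msupp (c *: f + g) `<=` msupp f `|` msupp g.
Proof.
apply: fsubset_trans (msuppD_le _ _) _.
by apply: fsetUSS => //; apply: msuppZ_le.
Qed.

Lemma evalW_linear (A : wAlgType W) (a : nat -> A) : linear (evalW a).
Proof.
move=> c f g; rewrite (evalWw _ (msupp_comb c f g)).
rewrite (evalWw _ (fsubsetUl (msupp f) (msupp g))).
rewrite (evalWw _ (fsubsetUr (msupp f) (msupp g))).
rewrite scaler_sumr -big_split /=; apply: eq_bigr => m _.
by rewrite mcoeffD mcoeffZ scalerDl scalerA.
Qed.

Lemma evalWU (A : wAlgType W) (a : nat -> A) (m : gmonom) :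
  evalW a (<< m >> : freeW) = eval_gmonom a m.
Proof. by rewrite /evalW msuppU oner_eq0 big_seq_fset1 mcoeffUU scale1r. Qed.

Lemma is_subspace_IdW (A : wAlgType W) : is_subspace (IdW A).
Proof.
split=> [a|c f g fA gA a]; first exact/linear_zero/evalW_linear.
by rewrite evalW_linear fA gA scaler0 addr0.
Qed.

Definition letters_in (L : seq nat -> Prop) (f : freeW) : Prop :=
  forall m, m \in msupp f -> L (gletters m).

Lemma is_subspace_letters_in (L : seq nat -> Prop) : is_subspace (letters_in L).
Proof.
split=> [m|c f g fL gL m]; first by rewrite msupp0 in_fset0.
by move/(fsubsetP (msupp_comb c f g)); rewrite in_fsetU => /orP [/fL|/gL].
Qed.

Lemma is_subspace_multilinear n : is_subspace (multilinearW n : set freeW).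
Proof. exact: (is_subspace_letters_in (fun l => perm_eq l (iota 0 n))). Qed.

Lemma is_subspace_multilinear_Id n (A : wAlgType W) :
  is_subspace (multilinearW n `&` IdW A)%classic.
Proof.
have [P0 PD] := is_subspace_multilinear n.
have [Q0 QD] := is_subspace_IdW A.
by split=> [|c u v [Pu Qu] [Pv Qv]]; split; auto.
Qed.

(** * Functions given by generalized polynomials *)

Lemma wbasis_expand (w : W) :
  exists (s : seq wbasis) (c : wbasis -> F), w = \sum_(v <- s) c v *: val v.
Proof.
have [_ /(_ w) [s [c sB ->]]] := @fixed_basisP F W.
exists (pmap insub s), (fun v => c (val v)).
elim: s sB => [|v s IHs] sB; first by rewrite !big_nil.
have Bv : v \in @fixed_basis F W by rewrite inE; apply: sB; rewrite mem_head.
rewrite big_cons /= insubT /= big_cons /= -IHs // => u us.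
by apply: sB; rewrite inE us orbT.
Qed.

(** The element [f] does not depend on [D]: this is what lets a computation made
    in one algebra be carried to another one that satisfies its identities. The
    predicate [L] on the words of variables keeps track of multilinearity. *)
Definition realizes (L : seq nat -> Prop)
    (phi : forall D : wAlgType W, (nat -> D) -> D) : Prop :=
  exists2 f : freeW, letters_in L f & forall D a, evalW a f = phi D a.

Implicit Types (L : seq nat -> Prop)
  (phi psi : forall D : wAlgType W, (nat -> D) -> D).

Lemma realizes_eval L (f : freeW) :
  letters_in L f -> realizes L (fun D a => evalW a f).
Proof. by exists f. Qed.

Lemma realizes_ext L phi psi :
  (forall D a, phi D a = psi D a) -> realizes L phi -> realizes L psi.
Proof. by move=> E [f fL fE]; exists f => // D a; rewrite fE E. Qed.

Lemma realizes_comb L (I : eqType) (r : seq I) (c : I -> F)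
    (phi : I -> forall D : wAlgType W, (nat -> D) -> D) :
  (forall i, i \in r -> realizes L (phi i)) ->
  realizes L (fun D a => \sum_(i <- r) c i *: phi i D a).
Proof.
move=> H.
have {}H i : exists f : freeW, i \in r ->
    letters_in L f /\ forall D a, evalW a f = phi i D a.
  have [/H [f fL fE]|_] := boolP (i \in r); last by exists 0.
  by exists f.
have [f fP] := choice H.
exists (\sum_(i <- r | i \in r) c i *: f i).
  apply: (is_subspace_sum _ _ (is_subspace_letters_in L)) => i /fP [fL _].
  exact: fL.
move=> D a; rewrite linear_comb; last exact: evalW_linear.
by rewrite [RHS]big_seq; apply: eq_bigr => i /fP [_ ->].
Qed.

Lemma realizes_gmonom L (m : gmonom) :
  L (gletters m) -> realizes L (fun D a => eval_gmonom a m).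
Proof.
move=> Lm; exists << m >>; last by move=> D a; rewrite evalWU.
by move=> m'; rewrite msuppU oner_eq0 in_fset1 => /eqP ->.
Qed.

(** A linear operation has to be realized on monomials only. *)
Lemma realizes_linear L L' (Op : forall D : wAlgType W, (nat -> D) -> D -> D) phi :
  (forall D a, linear (Op D a)) ->
  (forall m, L (gletters m) -> realizes L' (fun D a => Op D a (eval_gmonom a m))) ->
  realizes L phi -> realizes L' (fun D a => Op D a (phi D a)).
Proof.
move=> Opl Opm [f fL fE].
apply: (@realizes_ext _
  (fun D a => \sum_(m <- msupp f) f@_m *: Op D a (eval_gmonom a m))).
  by move=> D a; rewrite -fE /evalW linear_comb //; apply: Opl.
by apply: realizes_comb => m /fL /Opm.
Qed.

(** An operation that is linear in a coefficient from [W] has to be realized for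
    the coefficients in the fixed basis only. *)
Lemma realizes_expand L (Op : forall D : wAlgType W, (nat -> D) -> W -> D) (w : W) :
  (forall D a, linear (Op D a)) ->
  (forall v : wbasis, realizes L (fun D a => Op D a (val v))) ->
  realizes L (fun D a => Op D a w).
Proof.
move=> Opl Opv; have [s [c ->]] := wbasis_expand w.
apply: (@realizes_ext _ (fun D a => \sum_(v <- s) c v *: Op D a (val v))).
  by move=> D a; rewrite linear_comb //; apply: Opl.
exact: realizes_comb.
Qed.

Lemma eval_gmonom_rcons (A : wAlgType W) (a : nat -> A) w p s q :
  eval_gmonom a (w, p, rcons s q)
  = wmul (eval_gmonom a (w, p, s)) (ract (a q.1) (val q.2)).
Proof. by rewrite /eval_gmonom /= foldl_rcons. Qed.

Lemma realizes_rcons L L' phi j w :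
  (forall l, L l -> L' (rcons l j)) -> realizes L phi ->
  realizes L' (fun D a => wmul (phi D a) (ract (a j) w)).
Proof.
move=> LL'; apply: (realizes_linear (Op := fun D a b => wmul b (ract (a j) w))).
  by move=> D a; apply: wmul_linearl.
move=> [[w0 p] s] Lm; apply: (realizes_expand
    (Op := fun D a w => wmul (eval_gmonom a (w0, p, s)) (ract (a j) w))).
  by move=> D a c x y; rewrite ract_linearr wmul_linearr.
move=> v; apply: (@realizes_ext _ (fun D a => eval_gmonom a (w0, p, rcons s (j, v)))).
  by move=> D a; rewrite eval_gmonom_rcons.
by apply: realizes_gmonom; rewrite /gletters /= map_rcons -rcons_cons; apply: LL'.
Qed.

Lemma realizes_word1 L (w : W) j (w' : W) :
  L [:: j] -> realizes L (fun D a => lact w (ract (a j) w')).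
Proof.
move=> Lj; apply: (realizes_expand (Op := fun D a w => lact w (ract (a j) w'))).
  by move=> D a; apply: lact_linearl.
move=> v; apply: (realizes_expand
    (Op := fun D a w' => lact (val v) (ract (a j) w'))).
  by move=> D a c x y; rewrite ract_linearr lact_linearr.
by move=> v'; apply: (@realizes_gmonom _ (v, (j, v'), [::])).
Qed.

(** The left action is absorbed by the first coefficient of the word, which can
    then be expanded in the basis again. *)
Lemma lact_eval_gmonom (A : wAlgType W) (a : nat -> A) w w0 p s :
  lact w (eval_gmonom a (w0, p, s))
  = foldl (fun b (q : nat * wbasis) => wmul b (ract (a q.1) (val q.2)))
      (lact (w * val w0) (ract (a p.1) (val p.2))) s.
Proof.
elim/last_ind: s => [|s q IHs]; first by rewrite /= lactM.
by rewrite eval_gmonom_rcons foldl_rcons wmul_lact IHs.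
Qed.

Lemma realizes_lact L phi w :
  realizes L phi -> realizes L (fun D a => lact w (phi D a)).
Proof.
apply: (realizes_linear (Op := fun D a b => lact w b)).
  by move=> D a; apply: lact_linearr.
move=> [[w0 p] s] Lm.
apply: (realizes_ext (fun D a => esym (lact_eval_gmonom a w w0 p s))).
apply: (realizes_expand (Op := fun D a v =>
  foldl (fun b (q : nat * wbasis) => wmul b (ract (a q.1) (val q.2)))
      (lact v (ract (a p.1) (val p.2))) s)).
  move=> D a c x y; rewrite lact_linearl.
  elim: s {Lm} (lact x _) (lact y _) => //= q s IHs u v.
  by rewrite wmul_linearl IHs.
by move=> v; apply: (@realizes_gmonom _ (v, p, s)).
Qed.

Lemma realizes_ract L phi w :
  realizes L phi -> realizes L (fun D a => ract (phi D a) w).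
Proof.
apply: (realizes_linear (Op := fun D a b => ract b w)).
  by move=> D a; apply: ract_linearl.
move=> [[w0 [j v]] s]; elim/last_ind: s => [|s [i u] _] Lm.
  apply: realizes_ext (realizes_word1 (val w0) (val v * w) Lm).
  by move=> D a; rewrite /eval_gmonom /= lractA ractM.
apply: (@realizes_ext _ (fun D a =>
    wmul (eval_gmonom a (w0, (j, v), s)) (ract (a i) (val u * w)))).
  by move=> D a; rewrite eval_gmonom_rcons wmul_ract ractM.
apply: (@realizes_rcons (fun l => L (rcons l i))) => //.
by apply: realizes_gmonom; move: Lm; rewrite /gletters /= map_rcons -rcons_cons.
Qed.

Definition any_letters (l : seq nat) : Prop := True.

Lemma realizes_mul phi psi :
  realizes any_letters phi -> realizes any_letters psi ->
  realizes any_letters (fun D a => wmul (phi D a) (psi D a)).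
Proof.
move=> Rphi; apply: (realizes_linear (Op := fun D a b => wmul (phi D a) b)).
  by move=> D a; apply: wmul_linearr.
move=> [[w0 [j v]] s] _; elim/last_ind: s => [|s [i u] IHs].
  apply: (@realizes_ext _ (fun D a =>
      wmul (ract (phi D a) (val w0)) (ract (a j) (val v)))).
    by move=> D a; rewrite wmul_mid.
  by apply: realizes_rcons (realizes_ract _ Rphi).
apply: (@realizes_ext _ (fun D a =>
    wmul (wmul (phi D a) (eval_gmonom a (w0, (j, v), s))) (ract (a i) (val u)))).
  by move=> D a; rewrite eval_gmonom_rcons wmulA.
exact: realizes_rcons IHs.
Qed.

(** Sets of identities are stable under substitution: the substituted polynomial
    is itself an element of the free algebra. *)
Lemma realizes_subst (f : freeW) (u : nat -> freeW) :
  realizes any_letters (fun D a => evalW (fun i => evalW a (u i)) f).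
Proof.
have Ru i : realizes any_letters (fun D a => evalW a (u i)) by apply: realizes_eval.
apply: realizes_comb => -[[w0 [j v]] s] _; elim/last_ind: s => [|s [i x] IHs].
  exact/realizes_lact/realizes_ract.
apply: (@realizes_ext _ (fun D a =>
    wmul (eval_gmonom (fun i => evalW a (u i)) (w0, (j, v), s))
      (ract (evalW a (u i)) (val x)))).
  by move=> D a; rewrite eval_gmonom_rcons.
exact/realizes_mul/realizes_ract.
Qed.

End Evaluation.

(** * Multilinearity of evaluations *)

Section Multilinearity.
Variables (F : fieldType) (W : algType F) (D : wAlgType W).
Local Notation wbasis := (wbasis W).

Definition eval_tail (a : nat -> D) (b : D) (s : seq (nat * wbasis)) : D :=
  foldl (fun b (q : nat * wbasis) => wmul b (ract (a q.1) (val q.2))) b s.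

Definition update (a : nat -> D) (i : nat) (x : D) : nat -> D :=
  fun j => if j == i then x else a j.

Lemma eval_tail_linear (a : nat -> D) s : linear (eval_tail a ^~ s).
Proof.
elim: s => // q s IHs c x y; rewrite /eval_tail /= wmul_linearl; exact: IHs.
Qed.

Lemma eq_eval_tail (a a' : nat -> D) b s :
  {in map fst s, a =1 a'} -> eval_tail a b s = eval_tail a' b s.
Proof.
elim: s b => //= q s IHs b aa'; rewrite /eval_tail /= aa' ?mem_head //.
by apply: IHs => j js; apply: aa'; rewrite inE js orbT.
Qed.

Lemma eval_tail_update (a : nat -> D) i x b s :
  i \notin map fst s -> eval_tail (update a i x) b s = eval_tail a b s.
Proof.
move=> is'; apply: eq_eval_tail => j js; rewrite /update.
by case: eqP js is' => // -> ->.
Qed.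

Lemma eval_tail_multilinear (a : nat -> D) i b s :
  uniq (map fst s) -> i \in map fst s ->
  linear (fun x => eval_tail (update a i x) b s).
Proof.
elim: s b => //= q s IHs b /andP [qs us]; rewrite inE => /predU1P [iq|ins] c x y.
  rewrite /eval_tail /=.
  have E z b' : foldl (fun b (q : nat * wbasis) =>
      wmul b (ract (update a i z q.1) (val q.2))) b' s = eval_tail a b' s.
    by rewrite -(@eval_tail_update a i z) ?iq.
  rewrite !E -eval_tail_linear; congr eval_tail.
  by rewrite /update iq eqxx ract_linearl wmul_linearr.
rewrite /eval_tail /=; have qi : (q.1 == i) = false.
  by apply: contraNF qs => /eqP ->.
rewrite [update _ _ _ q.1]/update [update _ _ x q.1]/update.
rewrite [update _ _ y q.1]/update qi.
exact: IHs.
Qed.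

Lemma eval_gmonom_multilinear (a : nat -> D) i m :
  uniq (gletters m) -> i \in gletters m ->
  linear (fun x => eval_gmonom (update a i x) m).
Proof.
case: m => [[w [j v]] s]; rewrite /gletters /= inE => /andP [js us].
case/predU1P => [ij|ins] c x y; rewrite /eval_gmonom /= -!/(eval_tail _ _ s).
  rewrite !eval_tail_update ?ij // -eval_tail_linear; congr eval_tail.
  by rewrite /update eqxx ract_linearl lact_linearr.
have ji : (j == i) = false by apply: contraNF js => /eqP ->.
rewrite [update _ _ _ j]/update [update _ _ x j]/update.
rewrite [update _ _ y j]/update ji.
exact: eval_tail_multilinear.
Qed.

Lemma eq_eval_gmonom (a a' : nat -> D) m :
  {in gletters m, a =1 a'} -> eval_gmonom a m = eval_gmonom a' m.
Proof.
case: m => [[w [j v]] s] aa'; rewrite /eval_gmonom /= -!/(eval_tail _ _ s).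
rewrite (@eq_eval_tail a a') ?aa' ?mem_head // => l ls.
by apply: aa'; rewrite inE ls orbT.
Qed.

(** Each variable below [n] occurs exactly once in each monomial of [f]. *)
Lemma evalW_multilinear (a : nat -> D) n (f : freeW W) i :
  multilinearW n f -> (i < n)%N -> linear (fun x => evalW (update a i x) f).
Proof.
move=> fn ltin c x y; rewrite /evalW scaler_sumr -big_split /=.
rewrite !big_seq; apply: eq_bigr => m /fn mn.
rewrite eval_gmonom_multilinear ?(perm_uniq mn) ?iota_uniq //.
  by rewrite scalerDr !scalerA mulrC.
by rewrite (perm_mem mn) mem_iota.
Qed.

Lemma eq_evalW_multilinear (a a' : nat -> D) n (f : freeW W) :
  multilinearW n f -> (forall i, (i < n)%N -> a i = a' i) ->
  evalW a f = evalW a' f.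
Proof.
move=> fn aa'; rewrite /evalW !big_seq; apply: eq_bigr => m /fn mn.
congr (_ *: _); apply: eq_eval_gmonom => i.
by rewrite (perm_mem mn) mem_iota => /aa'.
Qed.

End Multilinearity.

Section MatrixCodim.
Variables (F : fieldType) (W : algType F) (k : nat).
Variables (theta : {linear W -> 'M[F]_k}) (thetaM : monoid_morphism theta).
Local Notation A := (matW thetaM : wAlgType W).
Local Notation E i j := (delta_mx i j : 'M[F]_k).

Lemma wmul_ract_matW (M N : A) w :
  wmul M (ract N w) = (M : 'M[F]_k) *m ((N : 'M[F]_k) *m theta w).
Proof. by []. Qed.

Lemma lact_ract_matW (M : A) v w :
  lact v (ract M w) = theta v *m ((M : 'M[F]_k) *m theta w).
Proof. by []. Qed.

Lemma lact_matW (M : A) v : lact v M = theta v *m (M : 'M[F]_k).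
Proof. by []. Qed.

Lemma ract_matW (M : A) w : ract M w = (M : 'M[F]_k) *m theta w.
Proof. by []. Qed.

(** The arguments are freed one at a time: by multilinearity, the [m]-th one may
    be arbitrary once [f] vanishes when it is any matrix unit. *)
Lemma multilinear_Id_delta n (f : freeW W) :
  multilinearW n f ->
  (forall a : nat -> A,
     (forall i, (i < n)%N -> exists p q, a i = E p q) -> evalW a f = 0) ->
  IdW A f.
Proof.
move=> fn f0.
suff H m : (m <= n)%N -> forall a : nat -> A,
    (forall i, (m <= i < n)%N -> exists p q, a i = E p q) -> evalW a f = 0.
  by move=> a; apply: (H n) => // i; case: ltngtP.
elim: m => [_|m IHm ltmn] a aE; first by apply: f0 => i /aE.
have -> : evalW a f = evalW (update a m (a m)) f.
  by apply: (eq_evalW_multilinear fn) => i _; rewrite /update; case: eqP => // ->.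
apply: (@linear_delta_eq0 F k k A (fun x => evalW (update a m x) f)).
  exact: (@evalW_multilinear _ _ A a n f m fn ltmn).
move=> p q; apply: IHm; first exact: ltnW.
move=> i; rewrite leq_eqVlt eq_sym /update; case: eqVneq => [_ _|_ /= lti].
  by exists p, q.
exact: aE.
Qed.

Definition delta_args n (g : {ffun 'I_n -> 'I_k * 'I_k}) (i : nat) : A :=
  if insub i is Some j then E (g j).1 (g j).2 else 0.

Definition value_index n : finType := ({ffun 'I_n -> 'I_k * 'I_k} * 'I_k * 'I_k)%type.

Definition delta_values n (f : freeW W) : 'rV[F]_#|value_index n| :=
  \row_x (evalW (delta_args (enum_val x).1.1) f : 'M[F]_k)
     (enum_val x).1.2 (enum_val x).2.

Lemma delta_values_linear n : linear (@delta_values n).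
Proof. by move=> c f g; apply/rowP => x; rewrite !mxE evalW_linear !mxE. Qed.

Lemma delta_values_eq0 n (f : freeW W) :
  multilinearW n f -> delta_values n f = 0 -> IdW A f.
Proof.
move=> fn /rowP f0; apply: (multilinear_Id_delta fn) => a aE.
have {}aE (i : 'I_n) : exists pq, a i = E pq.1 pq.2.
  by have [p [q ->]] := aE i (ltn_ord i); exists (p, q).
have [g gE] := choice aE.
rewrite (@eq_evalW_multilinear _ _ _ _ (delta_args [ffun i => g i]) _ _ fn).
  apply/matrixP => p q.
  have := f0 (enum_rank ([ffun i => g i], p, q)).
  by rewrite !mxE enum_rankK.
by move=> i ltin; rewrite /delta_args; case: insubP => [j _ <-|/negP//];
  rewrite ffunE -gE.
Qed.

(** A multilinear [f] is determined modulo the identities by finitely many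
    scalars, its values at tuples of matrix units; the identities of [B] can only
    reduce the dimension further. *)
Lemma codim_bound (B : wAlgType W) n :
  (IdW A `<=` IdW B)%classic ->
  exists2 d, codimV (varW B) n = Some d & (d <= #|value_index n|)%N.
Proof.
move=> AB; rewrite /codimV IdV_varW; apply: (quotient_dim_le (Phi := @delta_values n)).
- exact: is_subspace_multilinear.
- exact: is_subspace_multilinear_Id.
- exact: delta_values_linear.
- by move=> f fn /(delta_values_eq0 fn) /AB fB.
Qed.

End MatrixCodim.

(** * Exponential growth of the codimensions *)

Lemma expn_gt_poly C t :
  exists2 n, (0 < n)%N & (C * n ^ t < 2 ^ n)%N.
Proof.
(* With n = 2 ^ (2 r) it is enough that C + 2 r t <= r ^ 2 <= 2 ^ (2 r). *)
pose r := (C + 2 * t + 1)%N.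
exists (2 ^ (2 * r))%N; first by rewrite expn_gt0.
rewrite -expnM; apply: (@leq_trans (2 ^ C * 2 ^ (2 * r * t))).
  by rewrite ltn_mul2r expn_gt0 ltn_expl.
rewrite -expnD leq_exp2l //.
have ltr : (r < 2 ^ r)%N by apply: ltn_expl.
apply: (@leq_trans (r * r)); first by rewrite /r; nia.
by rewrite mul2n -addnn expnD leq_mul // ltnW.
Qed.

Section LowerBound.
Variables (F : fieldType) (W : algType F) (k : nat) (k_gt0 : (0 < k)%N).
Variables (theta : {linear W -> 'M[F]_k.+1}) (thetaM : monoid_morphism theta).
Variables (rep : 'M[F]_k.+1 -> W) (repK : cancel rep theta).
Local Notation A := (matW thetaM : wAlgType W).
Local Notation E i j := (delta_mx i j : 'M[F]_k.+1).

Fixpoint unit_word (r : nat -> 'I_k.+1) n (D : wAlgType W) (a : nat -> D) : D :=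
  if n is n'.+1 then
    wmul (unit_word r n' a) (ract (a n) (rep (E 0 (r n.+1))))
  else lact (rep (E 0 (r 0%N))) (ract (a 0%N) (rep (E 0 (r 1%N)))).

Lemma realizes_unit_word r n :
  realizes (fun l => perm_eq l (iota 0 n.+1)) (@unit_word r n).
Proof.
suff: realizes (fun l => l = iota 0 n.+1) (@unit_word r n).
  by move=> [f fL fE]; exists f => // m /fL ->.
elim: n => [|n IHn]; first exact: realizes_word1.
apply: realizes_rcons IHn => l ->.
by rewrite -[in RHS]addn1 iotaD /= cats1.
Qed.

(** The word attached to [r] reads the entry in row [r i] and column 0 of its
    [i]-th argument; hence the words and the tuples of matrix units [E (t i) 0]
    are dual to each other. *)
Lemma eval_unit_word r t n :
  unit_word r n (fun i => E (t i) 0 : A)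
  = (all (fun i => r i == t i) (iota 0 n.+1))%:R *: E 0 (r n.+1).
Proof.
have step (i j l : 'I_k.+1) : E 0 i *m (E j 0 *m E 0 l) = (i == j)%:R *: E 0 l.
  by rewrite mul_delta_mx mul_delta_mx_cond scaler_nat.
elim: n => [|n IHn].
  by rewrite /= lact_ract_matW !repK step andbT.
have -> : iota 0 n.+2 = iota 0 n.+1 ++ [:: n.+1] by rewrite -[in LHS]addn1 iotaD.
rewrite all_cat [all _ [:: _]]/= andbT [unit_word _ _ _]/= IHn.
rewrite wmul_ract_matW repK -scalemxAl step scalerA.
by rewrite -natrM mulnb.
Qed.

(** Two rows suffice for exponentially many words. *)
Definition word_rows n (s : {ffun 'I_n.+1 -> bool}) (i : nat) : 'I_k.+1 :=
  if s (inord i) then ord_max else ord0.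

Lemma codim_ge_expn n d : codimV (varW A) n.+1 = Some d -> (2 ^ n.+1 <= d)%N.
Proof.
have -> : (2 ^ n.+1 = #|{: {ffun 'I_n.+1 -> bool}}|)%N.
  by rewrite card_ffun card_bool card_ord.
have /choice [f fP] (x : 'I_#|{: {ffun 'I_n.+1 -> bool}}|) :
    exists f : freeW W, multilinearW n.+1 f /\
      forall a : nat -> A, evalW a f = unit_word (word_rows (enum_val x)) n a.
  by have [f fL fE] := realizes_unit_word (word_rows (enum_val x)) n; exists f.
rewrite /codimV IdV_varW.
apply: (quotient_dim_ge (x := f)) => [||c [_ fI] x].
- exact: is_subspace_multilinear_Id.
- by move=> x; case: (fP x).
have := fI (fun i => E (word_rows (enum_val x) i) 0).
rewrite linear_comb; last exact: evalW_linear.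
rewrite (bigD1 x) //= big1 ?addr0; last first.
  move=> y yx; have [_ ->] := fP y; rewrite eval_unit_word.
  case: allP => [rows|]; last by rewrite scale0r scaler0.
  case/eqP: yx; apply: enum_val_inj; apply/ffunP => i.
  have := rows i; rewrite mem_iota /= add0n ltn_ord /word_rows inord_val.
  move=> /(_ isT); case: (enum_val y i) (enum_val x i) => -[] //=.
    by rewrite -val_eqE /= eqn0Ngt k_gt0.
  by rewrite -val_eqE /= eq_sym eqn0Ngt k_gt0.
have [_ ->] := fP x; rewrite eval_unit_word.
have -> : all (fun i => word_rows (enum_val x) i == word_rows (enum_val x) i)
    (iota 0 n.+1) by apply/allP.
rewrite scale1r => /(congr1 (fun M : 'M[F]_k.+1 =>
  M 0 (word_rows (enum_val x) n.+1))).
by rewrite !mxE !eqxx mulr1.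
Qed.

Lemma not_polynomial_growth_matW : ~ polynomial_growth (varW A).
Proof.
move=> [C [t growth]]; have [n n0 ltn] := expn_gt_poly C t.
have [d dE dle] := growth n n0.
case: n n0 ltn dE dle => // n _ ltn /codim_ge_expn le2 dle.
by have := leq_trans le2 dle; rewrite leqNgt ltn.
Qed.

End LowerBound.

(** * Proper subvarieties are nilpotent *)

(** The Vandermonde matrix at the nodes [0, ..., n - 1] is invertible in
    characteristic zero. *)
Lemma subspace_power_coef (F : fieldType) (V : lmodType F) (S : V -> Prop) n
    (v : 'I_n -> V) :
  [pchar F] =i pred0 -> is_subspace S ->
  (forall c : F, S (\sum_(i < n) c ^+ i *: v i)) -> forall i, S (v i).
Proof.
move=> charF0 Ss Sv i.
pose M := Vandermonde n (\row_(l < n) (l%:R : F)).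
have Mu : M \in unitmx.
  rewrite unitmxE det_Vandermonde unitfE; apply/prodf_neq0 => p _.
  apply/prodf_neq0 => q ltpq; rewrite !mxE subr_eq0.
  rewrite -(subnKC (ltnW ltpq)) natrD -subr_eq0 addrC addKr.
  by rewrite ((pcharf0P F).1 charF0) -lt0n subn_gt0.
have -> : v i = \sum_(l < n) invmx M l i *: \sum_(j < n) l%:R ^+ j *: v j.
  under eq_bigr do rewrite scaler_sumr.
  rewrite exchange_big /= (bigD1 i) //= [X in _ + X]big1 ?addr0.
    under eq_bigr do rewrite scalerA mulrC.
    rewrite -scaler_suml; have /matrixP/(_ i i) := mulmxV Mu.
    rewrite !mxE eqxx => Mii; rewrite -[LHS]scale1r -[X in X *: _]Mii.
    by congr (_ *: _); apply: eq_bigr => l _; rewrite !mxE.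
  move=> j ji; under eq_bigr do rewrite scalerA mulrC.
  rewrite -scaler_suml; have /matrixP/(_ j i) := mulmxV Mu.
  rewrite !mxE (negbTE ji) => Mji; rewrite -[RHS](scale0r (v j)).
  rewrite -[X in _ = X *: _]Mji.
  by congr (_ *: _); apply: eq_bigr => l _; rewrite !mxE.
exact: is_subspace_sum.
Qed.

Lemma eval_gmonom_scale (F : fieldType) (W : algType F) (D : wAlgType W)
    (a : nat -> D) (x : F) (m : gmonom W) :
  eval_gmonom (fun i => x *: a i) m = x ^+ size (gletters m) *: eval_gmonom a m.
Proof.
have Z (U V : lmodType F) (f : U -> V) u : linear f -> f (x *: u) = x *: f u.
  by move=> fl; rewrite -[x *: u]addr0 fl (linear_zero fl) addr0.
case: m => [[w p] s]; elim/last_ind: s => [|s q IHs].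
  rewrite /eval_gmonom /= expr1 (Z _ _ (ract^~ _)); last exact: ract_linearl.
  by rewrite (Z _ _ (lact _)) //; apply: lact_linearr.
rewrite !eval_gmonom_rcons IHs (Z _ _ (ract^~ _)); last exact: ract_linearl.
rewrite (Z _ _ (wmul _)); last exact: wmul_linearr.
have -> : size (gletters (w, p, rcons s q)) = (size (gletters (w, p, s))).+1.
  by rewrite /gletters /= !size_map size_rcons.
have ZZ c u v : wmul (c *: u) v = c *: wmul u v :> D.
  rewrite -[c *: u]addr0 wmul_linearl.
  by rewrite (linear_zero (f := wmul^~ v)) ?addr0 //; apply: wmul_linearl.
by rewrite ZZ scalerA exprS.
Qed.

Section Nilpotency.
Variables (F : fieldType) (charF0 : [pchar F] =i pred0).
Variables (W : algType F) (k : nat).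
Variables (theta : {linear W -> 'M[F]_k.+1}) (thetaM : monoid_morphism theta).
Variables (rep : 'M[F]_k.+1 -> W) (repK : cancel rep theta).
Local Notation A := (matW thetaM : wAlgType W).
Local Notation E i j := (delta_mx i j : 'M[F]_k.+1).
Local Notation args := (nat -> 'M[F]_k.+1).
Variables (B : wAlgType W).

Definition Id_fun (phi : args -> 'M[F]_k.+1) : Prop :=
  exists2 f : freeW W, IdW B f & forall a : args, evalW (a : nat -> A) f = phi a.

Lemma is_subspace_Id_fun : is_subspace Id_fun.
Proof.
split=> [|c phi psi [f fB fE] [g gB gE]].
  by exists 0 => a; apply/linear_zero/evalW_linear.
exists (c *: f + g); first exact: (is_subspace_IdW B).2.
by move=> a; rewrite evalW_linear fE gE.
Qed.

Lemma Id_fun_lact phi M : Id_fun phi -> Id_fun (fun a => M *m phi a).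
Proof.
move=> [f fB fE]; have fL : letters_in (@any_letters) f by [].
have [g _ gE] := realizes_lact (rep M) (realizes_eval fL).
exists g => a.
  by rewrite gE fB; apply: (linear_zero (f := lact _)); apply: lact_linearr.
by rewrite gE lact_matW repK fE.
Qed.

Lemma Id_fun_ract phi M : Id_fun phi -> Id_fun (fun a => phi a *m M).
Proof.
move=> [f fB fE]; have fL : letters_in (@any_letters) f by [].
have [g _ gE] := realizes_ract (rep M) (realizes_eval fL).
exists g => a.
  by rewrite gE fB; apply: (linear_zero (f := ract^~ _)); apply: ract_linearl.
by rewrite gE ract_matW repK fE.
Qed.

Lemma Id_fun_mul_var phi j M : Id_fun phi -> Id_fun (fun a => phi a *m (a j *m M)).
Proof.
move=> [f fB fE]; have fL : letters_in (@any_letters) f by [].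
have [] := @realizes_rcons _ _ _ any_letters _ j (rep M) _ (realizes_eval fL).
  by [].
move=> g _ gE; exists g => a.
  by rewrite gE fB; apply: (linear_zero (f := wmul^~ _)); apply: wmul_linearl.
by rewrite gE wmul_ract_matW repK fE.
Qed.

Lemma Id_fun_subst (f : freeW W) (phi : nat -> args -> 'M[F]_k.+1)
    (u : nat -> freeW W) :
  IdW B f -> (forall i (a : args), evalW (a : nat -> A) (u i) = phi i a) ->
  Id_fun (fun a => evalW (fun i => phi i a : A) f).
Proof.
move=> fB uE; have [g _ gE] := realizes_subst f u.
exists g => a; first by rewrite gE fB.
by rewrite gE; congr (evalW _ f); apply: funext => i.
Qed.

(** The two-sided action of the full matrix ring makes [Id_fun] consist of the
    matrices with entries in an ideal of scalar functions, which is this one. The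
    codomain is [F^o] so that these functions form a vector space. *)
Definition Id_entry (h : args -> F^o) : Prop :=
  forall i j, Id_fun (fun a => h a *: E i j).

(** The scalar functions that may be substituted, times any constant matrix, for
    a variable: polynomials without constant term in the entries. *)
Definition poly_entry (g : args -> F^o) : Prop :=
  forall i j, exists u : freeW W,
    forall a : args, evalW (a : nat -> A) u = g a *: E i j.

Lemma is_subspace_Id_entry : is_subspace Id_entry.
Proof.
have [J0 JD] := is_subspace_Id_fun.
split=> [i j|c h h' hJ hJ' i j].
  by rewrite (_ : (fun _ => _) = 0) //; apply: funext => a; rewrite scale0r.
rewrite (_ : (fun _ => _) = c *: (fun a => h a *: E i j) + (fun a => h' a *: E i j)).
  exact: JD.
by apply: funext => a; rewrite !fctE scalerDl scalerA.
Qed.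

Lemma is_subspace_poly_entry : is_subspace poly_entry.
Proof.
split=> [i j|c g g' gR gR' i j].
  by exists 0 => a; rewrite scale0r; apply/linear_zero/evalW_linear.
have [[u uE] [u' uE']] := (gR i j, gR' i j).
by exists (c *: u + u') => a; rewrite evalW_linear uE uE' !fctE scalerDl scalerA.
Qed.

Lemma delta_mx_entry (i p q j : 'I_k.+1) (M : 'M[F]_k.+1) :
  E i p *m (M *m E q j) = M p q *: E i j.
Proof.
apply/matrixP => x y; rewrite mulmxA !mxE (bigD1 q) //= big1 ?addr0; last first.
  by move=> l lq; rewrite [E q j _ _]mxE (negbTE lq) mulr0.
rewrite !mxE (bigD1 p) //= big1 ?addr0; last first.
  by move=> l lq; rewrite !mxE (negbTE lq) andbF mul0r.
by rewrite !mxE !eqxx /= andbT; case: (x == i); case: (y == j);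
  rewrite ?(mul0r, mulr0, mul1r, mulr1).
Qed.

Lemma poly_entry_var n p q : poly_entry (fun a => a n p q).
Proof.
move=> i j; have [//|u _ uE] :=
  realizes_word1 (rep (E i p)) (rep (E q j)) (L := @any_letters) (j := n).
by exists u => a; rewrite uE lact_ract_matW !repK delta_mx_entry.
Qed.

Lemma Id_entry_mul_var h n p q : Id_entry h -> Id_entry (fun a => h a * a n p q).
Proof.
move=> hJ i j; have := Id_fun_mul_var n (E q j) (hJ i p).
congr Id_fun; apply: funext => a.
by rewrite -scalemxAl delta_mx_entry scalerA.
Qed.

Lemma Id_fun_entry h (M : 'M[F]_k.+1) p q :
  M p q != 0 -> Id_fun (fun a => h a *: M) -> Id_entry h.
Proof.
move=> Mpq hM i j; have := Id_fun_lact (E i p) (Id_fun_ract (E q j) hM).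
move/(is_subspaceZ (M p q)^-1 is_subspace_Id_fun); congr Id_fun.
apply: funext => a; rewrite fctE -scalemxAl -scalemxAr delta_mx_entry !scalerA.
by rewrite mulrAC mulVf // mul1r.
Qed.

(** Let [f] be nonzero at the constant matrices [al]. At [g al] it takes the value
    [\sum_i g ^ i V i], with [V i] the degree [i] part of [f] at [al], and some
    [V d] is nonzero. Scaling [g] separates the degrees. *)
Lemma Id_entry_power (f : freeW W) :
  IdW B f -> ~ IdW A f ->
  exists d, forall g, poly_entry g -> Id_entry (fun a => g a ^+ d).
Proof.
move=> fB /existsNP [al fal].
pose N := (\max_(m <- msupp f) size (gletters m)).+1.
pose V (i : 'I_N) : 'M[F]_k.+1 :=
  \sum_(m <- msupp f | size (gletters m) == i) f@_m *: eval_gmonom al m.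
have sumV (x : F) : evalW (fun i => x *: al i : A) f = \sum_(i < N) x ^+ i *: V i.
  transitivity (\sum_(i < N)
     \sum_(m <- msupp f | size (gletters m) == i)
       f@_m *: (eval_gmonom (fun i => x *: al i : A) m : 'M[F]_k.+1)).
    rewrite (exchange_big_dep predT) //= /evalW [LHS]big_seq [RHS]big_seq.
    apply: eq_bigr => m mf.
    have ltm : (size (gletters m) < N)%N.
      by rewrite /N ltnS (big_rem m) //= leq_maxl.
    rewrite (bigD1 (Ordinal ltm)) //= big1 ?addr0 // => i /andP [/eqP mi].
    by rewrite -val_eqE /= mi eqxx.
  apply: eq_bigr => i _; rewrite scaler_sumr; apply: eq_bigr => m /eqP mi.
  by rewrite eval_gmonom_scale mi [LHS]scalerA mulrC -scalerA.
have [d [p [q Vd]]] : exists d p q, V d p q != 0.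
  apply: contrapT => V0; apply: fal.
  have := sumV 1; under eq_fun do rewrite scale1r.
  move=> ->; apply: big1 => i _.
  suff -> : V i = 0 by rewrite scaler0.
  apply/matrixP => p q; rewrite [RHS]mxE; apply: contrapT => /eqP Vi.
  by apply: V0; exists i, p, q.
exists d => g gR; apply: (Id_fun_entry Vd).
apply: (subspace_power_coef (v := fun i a => g a ^+ (i : 'I_N) *: V i) charF0
  is_subspace_Id_fun) => c.
have cgR := is_subspaceZ c is_subspace_poly_entry gR.
have /choice [u uE] i : exists u : freeW W,
    forall a : args, evalW (a : nat -> A) u = c * g a *: al i.
  have /choice [U UE] (pq : 'I_k.+1 * 'I_k.+1) := cgR pq.1 pq.2.
  exists (\sum_pq (al i : 'M[F]_k.+1) pq.1 pq.2 *: U pq) => a.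
  rewrite linear_comb; last exact: evalW_linear.
  rewrite [al i in RHS]matrix_sum_delta pair_big scaler_sumr /=.
  by apply: eq_bigr => pq _; rewrite UE [LHS]scalerA [RHS]scalerA mulrC.
have := Id_fun_subst fB uE; congr Id_fun.
apply: funext => a; rewrite sumV fct_sumE; apply: eq_bigr => i _.
by rewrite fctE scalerA exprMn.
Qed.

(** The [m]-fold colon ideal of the ideal [Id_entry] by the entries of variables.
    The constant 1 belongs to it exactly if all products of [m] entries lie in
    [Id_entry], and multiplying by an entry lowers [m] by one. *)
Fixpoint absorbed m (h : args -> F^o) : Prop :=
  if m is m'.+1 then forall n p q, absorbed m' (fun a => h a * a n p q)
  else Id_entry h.

Lemma is_subspace_absorbed m : is_subspace (absorbed m).
Proof.
elim: m => [|m [IH0 IHD]]; first exact: is_subspace_Id_entry.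
split=> [n p q|c h h' hm hm' n p q] /=.
  by move: IH0; congr absorbed; apply: funext => a; rewrite mul0r.
move: (IHD c _ _ (hm n p q) (hm' n p q)); congr absorbed.
by apply: funext => a; rewrite !fctE mulrDl scalerAl.
Qed.

Lemma absorbed_mul_var m h n p q :
  absorbed m h -> absorbed m.-1 (fun a => h a * a n p q).
Proof. by case: m => [|m] //=; apply: Id_entry_mul_var. Qed.

(** Polarization: [(g + c y)^m h] is a polynomial in [c] whose linear coefficient
    is [m g^(m-1) y h]. *)
Lemma absorbed_power m h :
  (forall g, poly_entry g -> Id_entry (fun a => g a ^+ m * h a)) -> absorbed m h.
Proof.
elim: m h => [|m IHm] h hm.
  move: (hm _ (is_subspace_poly_entry).1); congr Id_entry.
  by apply: funext => a; rewrite expr0 mul1r.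
move=> n p q; apply: IHm => g gR.
have yR := poly_entry_var n p q.
have H := subspace_power_coef (n := m.+2)
  (v := fun i a => g a ^+ (m.+1 - i) * a n p q ^+ i *+ 'C(m.+1, i) * h a : F^o)
  charF0 is_subspace_Id_entry.
have {}H : Id_entry (fun a => g a ^+ m * a n p q *+ m.+1 * h a).
  have := H _ (Ordinal (isT : (1 < m.+2)%N)); rewrite /= subn1 bin1 /=.
  apply=> c.
  have := hm _ (is_subspace_poly_entry.2 c _ _ yR gR); congr Id_entry.
  apply: funext => a; rewrite !fctE addrC exprDn mulr_suml fct_sumE.
  apply: eq_bigr => i _.
  by rewrite fctE exprMn mulrCA -mulrnAr -mulrA.
move: (is_subspaceZ (m.+1%:R)^-1 is_subspace_Id_entry H); congr Id_entry.
apply: funext => a; rewrite !fctE -(mulr_natl (g a ^+ m * _)) -[_ *: _]/(_ * _).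
rewrite !mulrA mulVf.
  by rewrite mul1r -!mulrA [a n p q * _]mulrC.
by rewrite ((pcharf0P F).1 charF0).
Qed.

(** Each variable of a monomial contributes one more entry as a factor. *)
Lemma absorbed_eval_gmonom d m p q :
  absorbed d (fun=> 1) ->
  absorbed (d - size (gletters m))
    (fun a => (eval_gmonom (a : nat -> A) m : 'M[F]_k.+1) p q).
Proof.
move=> d1.
have step l (b : args -> 'M[F]_k.+1) j (M : 'M[F]_k.+1) :
    (forall p q, absorbed l (fun a => b a p q)) ->
    forall p q, absorbed l.-1 (fun a => (b a *m (a j *m M)) p q).
  move=> bl i i'.
  pose v (rs : 'I_k.+1 * 'I_k.+1) : args -> F^o :=
    fun a => b a i rs.1 * a j rs.1 rs.2.
  have := is_subspace_sum (index_enum _) (fun rs => M rs.2 i')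
    (is_subspace_absorbed l.-1) (fun rs (_ : predT rs) =>
      absorbed_mul_var j rs.1 rs.2 (bl i rs.1) : absorbed l.-1 (v rs)).
  congr absorbed; apply: funext => a; rewrite fct_sumE mxE.
  transitivity (\sum_r \sum_s M s i' * (b a i r * a j r s)).
    by rewrite pair_big.
  apply: eq_bigr => r _; rewrite mxE mulr_sumr; apply: eq_bigr => s _.
  by rewrite mulrC mulrA.
case: m => [[w x] s]; elim/last_ind: s p q => [|s y IHs] p q.
  rewrite /= subn1; apply: (step d (fun=> theta (val w))) => i j.
  have := is_subspaceZ (theta (val w) i j) (is_subspace_absorbed d) d1.
  by congr absorbed; apply: funext => a; rewrite fctE -[_ *: _]/(_ * _) mulr1.
have -> : size (gletters (w, x, rcons s y)) = (size (gletters (w, x, s))).+1.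
  by rewrite /gletters /= !size_map size_rcons.
rewrite subnS.
have := step _ _ y.1 (theta (val y.2)) IHs p q; congr absorbed.
by apply: funext => a; rewrite eval_gmonom_rcons.
Qed.

Hypothesis AB : (IdW A `<=` IdW B)%classic.

(** Two polynomials that agree on the matrices differ by an identity of [A], hence
    of [B]; so it is enough that the function given by [f] is in [Id_fun]. *)
Lemma Id_long_letters d (f : freeW W) :
  absorbed d (fun=> 1) -> letters_in (fun l => (d <= size l)%N) f -> IdW B f.
Proof.
move=> d1 fd; suff [g gB gE] : Id_fun (fun a => evalW (a : nat -> A) f).
  rewrite -[f](subrK g) -[f - g]scale1r; apply: (is_subspace_IdW B).2 _ => //.
  by apply: AB => a; rewrite -scaleN1r addrC evalW_linear gE scaleN1r addNr.
have fE : (fun a => evalW (a : nat -> A) f)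
    = \sum_(m <- msupp f | m \in msupp f)
        f@_m *: (fun a => eval_gmonom (a : nat -> A) m : 'M[F]_k.+1) :> (args -> _).
  by apply: funext => a; rewrite fct_sumE /evalW [LHS]big_seq.
rewrite fE; apply: is_subspace_sum => [|m mf]; first exact: is_subspace_Id_fun.
have mE : (fun a => eval_gmonom (a : nat -> A) m : 'M[F]_k.+1)
    = \sum_(pq : 'I_k.+1 * 'I_k.+1) 1 *: (fun a =>
        (eval_gmonom (a : nat -> A) m : 'M[F]_k.+1) pq.1 pq.2 *: E pq.1 pq.2)
    :> (args -> _).
  apply: funext => a; rewrite fct_sumE [LHS]matrix_sum_delta pair_big /=.
  by apply: eq_bigr => pq _; rewrite fctE scale1r.
rewrite mE; apply: is_subspace_sum => [|pq _]; first exact: is_subspace_Id_fun.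
have := absorbed_eval_gmonom m pq.1 pq.2 d1.
by move: (fd m mf); rewrite -subn_eq0 => /eqP ->; apply.
Qed.

End Nilpotency.

(** * Almost polynomial growth *)

Lemma polynomial_growth_eventually_zero (F : fieldType) (W : algType F)
    (V : wAlgType W -> Prop) (bound : nat -> nat) d0 :
  (forall n, exists2 d, codimV V n = Some d & (d <= bound n)%N) ->
  (forall n, (d0 <= n)%N -> codimV V n = Some 0%N) ->
  polynomial_growth V.
Proof.
move=> Vb V0; exists (\max_(n < d0) bound n), 0%N => n _; rewrite muln1.
have [/V0 ->|ltn] := leqP d0 n; first by exists 0%N.
have [d -> led] := Vb n; exists d => //; apply: leq_trans led _.
exact: (leq_bigmax (Ordinal ltn) (F := fun i : 'I_d0 => bound i)).
Qed.

Lemma codimV_eq0 (F : fieldType) (W : algType F) (B : wAlgType W) n :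
  (multilinearW n `<=` IdW B)%classic -> codimV (varW B) n = Some 0%N.
Proof.
move=> PB; rewrite /codimV IdV_varW.
have [||||d -> ] := @quotient_dim_le F W (multilinearW n)
  (multilinearW n `&` IdW B)%classic 0 (fun=> 0).
- exact: is_subspace_multilinear.
- exact: is_subspace_multilinear_Id.
- by move=> c u v; rewrite scaler0 addr0.
- by move=> f fn _; split=> //; apply: PB.
- by rewrite leqn0 => /eqP ->.
Qed.

(** For some [d], the algebra [B] satisfies all polynomials of degree at least
    [d], so that all but finitely many codimensions are zero. *)
Lemma polynomial_growth_proper (F : fieldType) (charF0 : [pchar F] =i pred0)
    (W : algType F) (k : nat) (theta : {linear W -> 'M[F]_k.+1})
    (thetaM : monoid_morphism theta)
    (theta_surj : forall M : 'M[F]_k.+1, exists w : W, theta w = M)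
    (B : wAlgType W) (f : freeW W) :
  (IdW (matW thetaM : wAlgType W) `<=` IdW B)%classic ->
  IdW B f -> ~ IdW (matW thetaM : wAlgType W) f ->
  polynomial_growth (varW B).
Proof.
move=> AB fB fA; have [rep repK] := choice theta_surj.
have [d gd] := Id_entry_power charF0 repK fB fA.
apply: (@polynomial_growth_eventually_zero _ _ _ (fun n => #|value_index k.+1 n|) d).
  by move=> n; apply: codim_bound AB.
move=> n led; apply: codimV_eq0 => g gn.
apply: (Id_long_letters repK AB (d := d)).
  apply: absorbed_power => // h /gd; congr Id_entry.
  by apply: funext => a; rewrite mulr1.
by move=> m /gn /perm_size ->; rewrite size_iota.
Qed.

Theorem theorem5p4 (F : fieldType) (charF0 : [pchar F] =i pred0)
    (W : algType F) (k : nat) (k_ge2 : (2 <= k)%N)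
    (theta : {linear W -> 'M[F]_k}) (thetaM : monoid_morphism theta)
    (theta_surj : forall M : 'M[F]_k, exists w : W, theta w = M) :
  almost_polynomial_growth (varW (matW thetaM : wAlgType W)).
Proof.
case: k k_ge2 theta thetaM theta_surj => [|[|k]] // _ theta thetaM theta_surj.
split=> [|U [B ->] [BA [D DA DB]]].
  have [rep repK] := choice theta_surj.
  exact: not_polynomial_growth_matW repK.
have [f fB fD] : exists2 f, IdW B f & ~ IdW D f.
  apply: contrapT => nf; apply: DB => f fB.
  by apply: contrapT => fD; apply: nf; exists f.
apply: (polynomial_growth_proper charF0 theta_surj) fB _; first by apply: BA.
by move=> /DA.
Qed.
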